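(* Let $n,d\ge 1$ be integers. The first abacus rook monoid $\mathring{R}_{d,n}$ is presented by the generators $\mathsf{s}_1,\dots,\mathsf{s}_{n-1}$, $r_1,\dots,r_n$, $\mathsf{o}_1,\dots,\mathsf{o}_n$ subject to the following relations (whenever the indices make sense): $$\mathsf{s}_i^2=1;\quad \mathsf{s}_i\mathsf{s}_j=\mathsf{s}_j\mathsf{s}_i\ (|i-j|>1);\quad \mathsf{s}_i\mathsf{s}_j\mathsf{s}_i=\mathsf{s}_j\mathsf{s}_i\mathsf{s}_j\ (|i-j|=1);$$ $$r_i^2=r_i;\quad r_ir_j=r_jr_i;\quad r_j\mathsf{s}_i=\mathsf{s}_ir_j\ (j\ne i,i+1);\quad r_i\mathsf{s}_i=\mathsf{s}_ir_{i+1};\quad r_{i+1}\mathsf{s}_i=\mathsf{s}_ir_i;\quad r_i\mathsf{s}_ir_i=r_ir_{i+1};$$ $$\mathsf{o}_i^d=1;\quad \mathsf{o}_i\mathsf{o}_j=\mathsf{o}_j\mathsf{o}_i;\quad \mathsf{o}_j\mathsf{s}_i=\mathsf{s}_i\mathsf{o}_{s_i(j)};$$ $$r_i\mathsf{o}_j=\mathsf{o}_jr_i\ (i\ne j);\quad r_i\mathsf{o}_i=\mathsf{o}_ir_i=r_i,$$ where $s_i(j)$ is the image of $j$ under the transposition $(i,i+1)$. Hence the framed rook monoid $R_{d,n}$ is isomorphic to $\mathring{R}_{d,n}$, and its cardinality is $\sum_{k=0}^n\binom{n}{k}^2k!\,d^k$.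
   Context: First abacus rook monoid: a rook diagram has $n$ points $1,\dots,n$ on a top line and $n$ points $1,\dots,n$ on a bottom line, together with $k\le n$ lines, each joining a top point to a bottom point, such that each point lies on at most one line (so it encodes a partial injective map of $\{1,\dots,n\}$). Each point not lying on a line is the endpoint of a ''broken arc'', whose other end is free. The elements of $\mathring{R}_{d,n}$ are the rook diagrams in which each line carries a number of beads in $\{0,\dots,d-1\}$ and broken arcs carry no beads (beads escape through free ends). The product $ab$ is obtained by placing $a$ above $b$ and concatenating; when two lines are joined into a line their numbers of beads are added modulo $d$; a line joined with a broken arc becomes a broken arc, and its beads are lost; arcs with two free ends are discarded. The elements: $\mathsf{s}_i$ is the bead-free diagram of the transposition $(i,i+1)$ (lines top $i$ – bottom $i+1$, top $i+1$ – bottom $i$, and top $j$ – bottom $j$ otherwise); $r_i$ is the bead-free diagram with lines top $j$ – bottom $j$ for $j\neq i$ and no line at top $i$ or bottom $i$; $\mathsf{o}_i$ is the identity diagram with one bead on the $i$-th line (beads counted modulo $d$). Framed rook monoid: $R_{d,n}$ is the monoid presented by generators $s_1,\dots,s_{n-1},p_1,\dots,p_n,z_1,\dots,z_n$ and relations: $s_i^2=1$, $s_is_j=s_js_i$ for $|i-j|>1$, $s_is_js_i=s_js_is_j$ for $|i-j|=1$; $p_i^2=p_i$, $p_ip_j=p_jp_i$; $p_is_j=s_jp_i$ for $i<j$; $p_is_j=s_jp_i=p_i$ for $1\le j<i\le n$; $p_is_ip_i=p_{i+1}$ for $1\le i\le n-1$; $z_i^d=1$, $z_iz_j=z_jz_i$;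 $z_js_i=s_iz_{s_i(j)}$; $p_iz_j=z_jp_i$ for $1\le i<j\le n$; $p_iz_j=z_jp_i=p_i$ for $1\le j\le i\le n$. *)

(* Defs.v *)
From HB Require Import structures.
From mathcomp Require Import all_boot ssralg zmodp perm.
From mathcomp Require Import boolp classical_sets functions cardinality.

Set Implicit Arguments.
Unset Strict Implicit.
Unset Printing Implicit Defensive.

Local Open Scope quotient_scope.

Section Presentation.
Variables (G : choiceType) (rel : seq G -> seq G -> Prop).

Inductive congruence : seq G -> seq G -> Prop :=
| congruence_rel u v : rel u v -> congruence u v
| congruence_refl u : congruence u u
| congruence_sym u v : congruence u v -> congruence v u
| congruence_trans u v w : congruence u v -> congruence v w -> congruence u w
| congruence_cat u u' v v' :
    congruence u u' -> congruence v v' -> congruence (u ++ v) (u' ++ v').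

Definition congruenceb (u v : seq G) : bool := `[< congruence u v >].

Lemma congruenceb_refl : reflexive congruenceb.
Proof. by move=> u; apply/asboolP/congruence_refl. Qed.

Lemma congruenceb_sym : symmetric congruenceb.
Proof.
by move=> u v; apply/idP/idP => /asboolP H; apply/asboolP/congruence_sym.
Qed.

Lemma congruenceb_trans : transitive congruenceb.
Proof.
move=> v u w /asboolP uv /asboolP vw; apply/asboolP.
exact: congruence_trans uv vw.
Qed.

Definition congruence_equiv : equiv_rel (seq G) :=
  EquivRel congruenceb congruenceb_refl congruenceb_sym congruenceb_trans.

Definition presented : Type := {eq_quot congruence_equiv}.
HB.instance Definition _ := Choice.on presented.
HB.instance Definition _ := Quotient.on presented.

Definition word_class (w : seq G) : presented := \pi_presented w.

Lemma word_classP (u v : seq G) :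
  word_class u = word_class v <-> congruence u v.
Proof. by split=> [/eqmodP/asboolP|H] //; apply/eqmodP/asboolP. Qed.

Lemma word_class_repr (x : presented) : word_class (repr x) = x.
Proof. exact: reprK. Qed.

Definition presented_mul (x y : presented) : presented :=
  word_class (repr x ++ repr y).

Lemma presented_mulE (u v : seq G) :
  presented_mul (word_class u) (word_class v) = word_class (u ++ v).
Proof.
by apply/word_classP/congruence_cat; apply/word_classP; rewrite word_class_repr.
Qed.

Lemma presented_mulA : associative presented_mul.
Proof.
move=> x y z; rewrite -(word_class_repr x) -(word_class_repr y).
by rewrite -(word_class_repr z) !presented_mulE catA.
Qed.

Lemma presented_mul1g : left_id (word_class [::]) presented_mul.
Proof. by move=> x; rewrite -(word_class_repr x) presented_mulE. Qed.

Lemma presented_mulg1 : right_id (word_class [::]) presented_mul.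
Proof. by move=> x; rewrite -(word_class_repr x) presented_mulE cats0. Qed.

HB.instance Definition _ := isMonoid.Build presented
  presented_mulA presented_mul1g presented_mulg1.

Definition presented_gen (a : G) : presented := word_class [:: a].

End Presentation.

Definition monoid_iso (M N : monoidType) (f : M -> N) : Prop :=
  monoid_morphism f /\ bijective f.

Definition isomorphic_monoids (M N : monoidType) : Prop :=
  exists f : M -> N, monoid_iso f.

Definition has_presentation (M : monoidType) (G : choiceType) (g : G -> M)
    (rel : seq G -> seq G -> Prop) : Prop :=
  exists f : presented rel -> M,
    monoid_iso f /\ forall a, f (presented_gen rel a) = g a.

(* The points 1, ..., n are the elements 0, ..., n.-1 of 'I_n; the index i of
   s_i ranges over 'I_n.-1, and s_i exchanges lo i and hi i. *)

Lemma hi_subproof n (i : 'I_n.-1) : i.+1 < n.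
Proof. by rewrite -ltn_predRL. Qed.

Definition lo n (i : 'I_n.-1) : 'I_n := widen_ord (leq_pred n) i.
Definition hi n (i : 'I_n.-1) : 'I_n := Ordinal (hi_subproof i).

Definition swap n (i : 'I_n.-1) : {perm 'I_n} := tperm (lo i) (hi i).

(* Numbers of beads modulo d, for d >= 1; the library's 'Z_d would be the
   integers modulo 2 when d = 1. *)
Definition beads (d : nat) := 'I_d.-1.+1.
HB.instance Definition _ d := Finite.on (beads d).
HB.instance Definition _ d := GRing.Zmodule.on (beads d).

(* f i = Some (j, b) when a line carrying b beads joins the top point i to the
   bottom point j, and f i = None when the top point i lies on no line. *)
Definition no_shared_bottom d n (f : {ffun 'I_n -> option ('I_n * beads d)}) :=
  [forall i, forall i', forall x, forall x',
    [&& f i == Some x, f i' == Some x' & x.1 == x'.1] ==> (i == i')].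

Record abacus_rook (d n : nat) := AbacusRook {
  lines :> {ffun 'I_n -> option ('I_n * beads d)};
  linesP : no_shared_bottom lines }.

HB.instance Definition _ d n := [isSub for @lines d n].
HB.instance Definition _ d n := [Finite of abacus_rook d n by <:].

Section AbacusRookMonoid.
Variables d n : nat.
Implicit Types a b c : abacus_rook d n.

Lemma no_shared_bottomP (f : {ffun 'I_n -> option ('I_n * beads d)}) :
  reflect (forall i i' x x', f i = Some x -> f i' = Some x' -> x.1 = x'.1 ->
             i = i') (no_shared_bottom f).
Proof.
apply: (iffP idP) => [H i i' x x' fi fi' xx'|H].
  move/forallP/(_ i)/forallP/(_ i')/forallP/(_ x)/forallP/(_ x'): H.
  by rewrite fi fi' xx' !eqxx => /eqP.
apply/forallP=> i; apply/forallP=> i'; apply/forallP=> x; apply/forallP=> x'.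
by apply/implyP=> /and3P[/eqP fi /eqP fi' /eqP xx']; apply/eqP/(H _ _ x x').
Qed.

Definition concat_lines a b : {ffun 'I_n -> option ('I_n * beads d)} :=
  [ffun i =>
    if a i is Some (j, x) then
      if b j is Some (k, y) then Some (k, (x + y)%R) else None
    else None].

Lemma concat_subproof a b : no_shared_bottom (concat_lines a b).
Proof.
apply/no_shared_bottomP => i i' x x'; rewrite !ffunE.
case ai: (a i) => [[j u]|] //; case bj: (b j) => [[k v]|] // [<-].
case ai': (a i') => [[j' u']|] //; case bj': (b j') => [[k' v']|] // [<-] /= kk'.
have jj' : j = j' by apply: (no_shared_bottomP _ (linesP b) _ _ _ _ bj bj').
exact: (no_shared_bottomP _ (linesP a) _ _ _ _ ai ai').
Qed.

(* a is placed above b, so lines are followed from a to b. *)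
Definition concat a b : abacus_rook d n := AbacusRook (concat_subproof a b).

Lemma perm_subproof (s : {perm 'I_n}) :
  no_shared_bottom [ffun i => Some (s i, 0%R : beads d)].
Proof.
apply/no_shared_bottomP => i i' x x'; rewrite !ffunE => -[<-] [<-] /=.
exact: perm_inj.
Qed.

Definition perm_rook (s : {perm 'I_n}) : abacus_rook d n :=
  AbacusRook (perm_subproof s).

Lemma remove_subproof (i : 'I_n) :
  no_shared_bottom [ffun j => if j == i then None else Some (j, 0%R : beads d)].
Proof.
apply/no_shared_bottomP => j j' x x'; rewrite !ffunE.
by case: ifP => // _ [<-]; case: ifP => // _ [<-].
Qed.

Lemma bead_subproof (i : 'I_n) :
  no_shared_bottom
    [ffun j => Some (j, if j == i then inZp 1 else 0%R : beads d)].
Proof. by apply/no_shared_bottomP=> j j' x x'; rewrite !ffunE => -[<-] [<-]. Qed.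

Lemma abacus_rookP a b : (forall i, a i = b i) -> a = b.
Proof. by move=> ab; apply/val_inj/ffunP. Qed.

Lemma concatA : associative concat.
Proof.
move=> a b c; apply: abacus_rookP => i; rewrite !ffunE.
case: (a i) => [[j x]|] //; rewrite !ffunE.
case: (b j) => [[k y]|] //; case: (c k) => [[l z]|] //.
by rewrite GRing.addrA.
Qed.

Lemma concat1g : left_id (perm_rook 1) concat.
Proof.
move=> a; apply: abacus_rookP => i; rewrite !ffunE perm1.
by case: (a i) => [[j x]|] //; rewrite GRing.add0r.
Qed.

Lemma concatg1 : right_id (perm_rook 1) concat.
Proof.
move=> a; apply: abacus_rookP => i; rewrite !ffunE.
by case: (a i) => [[j x]|] //; rewrite ffunE perm1 GRing.addr0.
Qed.

HB.instance Definition _ := isMonoid.Build (abacus_rook d n)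
  concatA concat1g concatg1.

Definition rook_s (i : 'I_n.-1) : abacus_rook d n := perm_rook (swap i).
Definition rook_r (i : 'I_n) : abacus_rook d n := AbacusRook (remove_subproof i).
Definition rook_o (i : 'I_n) : abacus_rook d n := AbacusRook (bead_subproof i).

End AbacusRookMonoid.

Inductive abacus_generator (n : nat) :=
| As of 'I_n.-1
| Ar of 'I_n
| Ao of 'I_n.

Definition abacus_generator_code n (a : abacus_generator n) :
    'I_n.-1 + ('I_n + 'I_n) :=
  match a with As i => inl i | Ar i => inr (inl i) | Ao i => inr (inr i) end.

Definition abacus_generator_decode n (c : 'I_n.-1 + ('I_n + 'I_n)) :=
  match c with inl i => As i | inr (inl i) => Ar i | inr (inr i) => Ao i end.

Lemma abacus_generator_codeK n :
  cancel (@abacus_generator_code n) (@abacus_generator_decode n).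
Proof. by case. Qed.

HB.instance Definition _ n :=
  Finite.copy (abacus_generator n) (can_type (@abacus_generator_codeK n)).

Definition abacus_generator_val d n (a : abacus_generator n) :
    abacus_rook d n :=
  match a with As i => rook_s d i | Ar i => rook_r d i | Ao i => rook_o d i end.

Inductive abacus_relation (d n : nat) :
    seq (abacus_generator n) -> seq (abacus_generator n) -> Prop :=
| abacus_ss i :
    abacus_relation d [:: As i; As i] [::]
| abacus_s_comm (i j : 'I_n.-1) : i.+1 < j \/ j.+1 < i ->
    abacus_relation d [:: As i; As j] [:: As j; As i]
| abacus_s_braid (i j : 'I_n.-1) : j = i.+1 :> nat \/ i = j.+1 :> nat ->
    abacus_relation d [:: As i; As j; As i] [:: As j; As i; As j]
| abacus_rr i :
    abacus_relation d [:: Ar i; Ar i] [:: Ar i]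
| abacus_r_comm i j :
    abacus_relation d [:: Ar i; Ar j] [:: Ar j; Ar i]
| abacus_rs_comm i j : j <> lo i -> j <> hi i ->
    abacus_relation d [:: Ar j; As i] [:: As i; Ar j]
| abacus_rs_lo i :
    abacus_relation d [:: Ar (lo i); As i] [:: As i; Ar (hi i)]
| abacus_rs_hi i :
    abacus_relation d [:: Ar (hi i); As i] [:: As i; Ar (lo i)]
| abacus_rsr i :
    abacus_relation d [:: Ar (lo i); As i; Ar (lo i)] [:: Ar (lo i); Ar (hi i)]
| abacus_o_pow i :
    abacus_relation d (nseq d (Ao i)) [::]
| abacus_o_comm i j :
    abacus_relation d [:: Ao i; Ao j] [:: Ao j; Ao i]
| abacus_os i j :
    abacus_relation d [:: Ao j; As i] [:: As i; Ao (swap i j)]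
| abacus_ro_comm i j : i <> j ->
    abacus_relation d [:: Ar i; Ao j] [:: Ao j; Ar i]
| abacus_ro i :
    abacus_relation d [:: Ar i; Ao i] [:: Ar i]
| abacus_or i :
    abacus_relation d [:: Ao i; Ar i] [:: Ar i].

Inductive framed_generator (n : nat) :=
| Fs of 'I_n.-1
| Fp of 'I_n
| Fz of 'I_n.

Definition framed_generator_code n (a : framed_generator n) :
    'I_n.-1 + ('I_n + 'I_n) :=
  match a with Fs i => inl i | Fp i => inr (inl i) | Fz i => inr (inr i) end.

Definition framed_generator_decode n (c : 'I_n.-1 + ('I_n + 'I_n)) :=
  match c with inl i => Fs i | inr (inl i) => Fp i | inr (inr i) => Fz i end.

Lemma framed_generator_codeK n :
  cancel (@framed_generator_code n) (@framed_generator_decode n).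
Proof. by case. Qed.

HB.instance Definition _ n :=
  Finite.copy (framed_generator n) (can_type (@framed_generator_codeK n)).

Inductive framed_relation (d n : nat) :
    seq (framed_generator n) -> seq (framed_generator n) -> Prop :=
| framed_ss i :
    framed_relation d [:: Fs i; Fs i] [::]
| framed_s_comm (i j : 'I_n.-1) : i.+1 < j \/ j.+1 < i ->
    framed_relation d [:: Fs i; Fs j] [:: Fs j; Fs i]
| framed_s_braid (i j : 'I_n.-1) : j = i.+1 :> nat \/ i = j.+1 :> nat ->
    framed_relation d [:: Fs i; Fs j; Fs i] [:: Fs j; Fs i; Fs j]
| framed_pp i :
    framed_relation d [:: Fp i; Fp i] [:: Fp i]
| framed_p_comm i j :
    framed_relation d [:: Fp i; Fp j] [:: Fp j; Fp i]
| framed_ps_comm (i : 'I_n) (j : 'I_n.-1) : i < j ->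
    framed_relation d [:: Fp i; Fs j] [:: Fs j; Fp i]
| framed_ps (i : 'I_n) (j : 'I_n.-1) : j < i ->
    framed_relation d [:: Fp i; Fs j] [:: Fp i]
| framed_sp (i : 'I_n) (j : 'I_n.-1) : j < i ->
    framed_relation d [:: Fs j; Fp i] [:: Fp i]
| framed_psp i :
    framed_relation d [:: Fp (lo i); Fs i; Fp (lo i)] [:: Fp (hi i)]
| framed_z_pow i :
    framed_relation d (nseq d (Fz i)) [::]
| framed_z_comm i j :
    framed_relation d [:: Fz i; Fz j] [:: Fz j; Fz i]
| framed_zs i j :
    framed_relation d [:: Fz j; Fs i] [:: Fs i; Fz (swap i j)]
| framed_pz_comm (i j : 'I_n) : i < j ->
    framed_relation d [:: Fp i; Fz j] [:: Fz j; Fp i]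
| framed_pz (i j : 'I_n) : j <= i ->
    framed_relation d [:: Fp i; Fz j] [:: Fp i]
| framed_zp (i j : 'I_n) : j <= i ->
    framed_relation d [:: Fz j; Fp i] [:: Fp i].

Definition framed_rook (d n : nat) := presented (@framed_relation d n).

(* Main.v *)
(* Every word in the generators s, r, o can be rewritten as a product of r's,
   then o's, then s's.  Two such products with the same rook diagram agree in
   any monoid satisfying the relations: the idempotents r_i commute, the o_i
   absorbed by the r's can be dropped and the others are only counted modulo d,
   and the permutation parts agree off the set l of removed points, so differ by
   a permutation supported in l.  The latter is a product of transpositions
   (x y) with x, y in l, absorbed because r_x r_y (x y) = r_x r_y.  That the
   s-part depends only on its permutation is the Coxeter presentation of S_n,
   obtained from the coset representatives s_m s_(m-1) ... s_j.

   For the framed monoid, the conjugates r_(i+1) = s_i r_i s_i of r_1 = p_1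
   satisfy the abacus relations and p_i = r_1 ... r_i, so completeness carries
   over from the abacus presentation.  Rook diagrams are counted by the set of
   top points lying on a line. *)
Require Import Defs.
From mathcomp Require Import all_boot ssralg zmodp perm.
From mathcomp Require Import boolp classical_sets functions cardinality.
From mathcomp Require Import zify.

Set Implicit Arguments.
Unset Strict Implicit.
Unset Printing Implicit Defensive.

(** * The Coxeter presentation of the symmetric group *)

Section Coxeter.
Local Open Scope group_scope.

Definition wprod (G : Type) (M : monoidType) (g : G -> M) (w : seq G) : M :=
  \prod_(a <- w) g a.

Lemma wprod_nil (G : Type) (M : monoidType) (g : G -> M) : wprod g [::] = 1.
Proof. exact: big_nil. Qed.

Lemma wprod_cons (G : Type) (M : monoidType) (g : G -> M) a w :
  wprod g (a :: w) = g a * wprod g w.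
Proof. exact: big_cons. Qed.

Lemma wprod_seq1 (G : Type) (M : monoidType) (g : G -> M) a :
  wprod g [:: a] = g a.
Proof. exact: big_seq1. Qed.

Lemma wprod_cat (G : Type) (M : monoidType) (g : G -> M) u v :
  wprod g (u ++ v) = wprod g u * wprod g v.
Proof. exact: big_cat. Qed.

Lemma wprod_map (G H : Type) (M : monoidType) (h : G -> H) (g : H -> M) w :
  wprod g (map h w) = wprod (g \o h) w.
Proof. exact: big_map. Qed.

Lemma wprod_commute (G : eqType) (M : monoidType) (g : G -> M) x w :
  (forall a, a \in w -> x * g a = g a * x) -> x * wprod g w = wprod g w * x.
Proof. by move=> H; rewrite /wprod big_seq; apply: commute_prod. Qed.

Definition coxeter (M : monoidType) (m : nat) (t : nat -> M) : Prop :=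
  [/\ forall i, i < m -> t i * t i = 1,
      forall i j, i.+1 < j -> j < m -> t i * t j = t j * t i &
      forall i, i.+1 < m -> t i * t i.+1 * t i = t i.+1 * t i * t i.+1].

Lemma coxeterW (M : monoidType) m k (t : nat -> M) :
  k <= m -> coxeter m t -> coxeter k t.
Proof.
move=> km [tt tC tB]; split=> [i ik|i j ij jk|i ik].
- by apply: tt; lia.
- by apply: tC; lia.
- by apply: tB; lia.
Qed.

(* The value outside the range of t is the junk value 1. *)
Definition extend_ord (M : monoidType) (m : nat) (t : 'I_m -> M) (k : nat) : M :=
  oapp t 1 (insub k).

Lemma extend_ordE (M : monoidType) m (t : 'I_m -> M) (i : 'I_m) : extend_ord t i = t i.
Proof. by rewrite /extend_ord valK. Qed.

Lemma coxeter_extend_ord (M : monoidType) m (t : 'I_m -> M) :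
  (forall i, t i * t i = 1) ->
  (forall i j : 'I_m, i.+1 < j -> t i * t j = t j * t i) ->
  (forall i j : 'I_m, j = i.+1 :> nat -> t i * t j * t i = t j * t i * t j) ->
  coxeter m (extend_ord t).
Proof.
move=> tt tC tB; split=> [i im|i j ij jm|i jm].
- by rewrite (extend_ordE t (Ordinal im)) tt.
- have im : i < m by lia.
  by rewrite (extend_ordE t (Ordinal im)) (extend_ordE t (Ordinal jm)) tC.
- have im : i < m by lia.
  by rewrite (extend_ordE t (Ordinal im)) (extend_ordE t (Ordinal jm)) tB.
Qed.

(** The descending word m, m-1, ..., j. For j from 0 to m+1 these words represent the m+2 cosets of
    the subgroup generated by the letters below [m]; [j = m.+1] gives the empty word. *)
Definition chain (m j : nat) : seq nat := rev (index_iota j m.+1).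

Lemma mem_chain m j i : (i \in chain m j) = (j <= i <= m).
Proof. by rewrite mem_rev mem_index_iota ltnS. Qed.

Lemma chain_nil m : chain m m.+1 = [::].
Proof. by rewrite /chain /index_iota subnn. Qed.

Lemma chain_rcons m j : j <= m -> chain m j = chain m j.+1 ++ [:: j].
Proof.
move=> jm; rewrite /chain /index_iota subSS subSn //= rev_cons -cats1.
by [].
Qed.

Lemma chain_cat m j k : j <= k -> k <= m.+1 ->
  chain m j = chain m k ++ rev (index_iota j k).
Proof.
move=> jk km; rewrite /chain -rev_cat /index_iota; congr rev.
have -> : m.+1 - j = (k - j) + (m.+1 - k) by lia.
by rewrite iotaD subnKC.
Qed.

(** A letter multiplied on the right of a coset representative either shortens it (i = j), lengthens
    it (i+1 = j), or passes through to the left: unchanged when i+1 < j, lowered by one when i >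
    j. *)
Lemma chain_step m i j : i <= m -> j <= m.+1 ->
  exists u j', [/\ all (gtn m) u, j' <= m.+1 &
    forall (M : monoidType) (t : nat -> M), coxeter m.+1 t ->
      wprod t (chain m j) * t i = wprod t u * wprod t (chain m j')].
Proof.
move=> im jm; have [ij|ji|ij] := ltngtP i j; last 1 first.
- exists [::], j.+1; rewrite -ij; split=> // M t [tt _ _].
  by rewrite chain_rcons // wprod_cat wprod_seq1 wprod_nil mul1g -mulgA tt ?mulg1.
- have [ij1|ij1] := eqVneq i.+1 j.
    exists [::], i; split=> //; first by lia.
    move=> M t _; rewrite wprod_nil mul1g -ij1 (chain_rcons im).
    by rewrite wprod_cat wprod_seq1.
  exists [:: i], j; split=> //=; first by rewrite andbT; lia.
  move=> M t [_ tC _]; rewrite wprod_seq1 wprod_commute // => a.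
  by rewrite mem_chain => ?; apply: tC; lia.
- case: i ji im => // i ji im; exists [:: i], j; split=> //=; first by rewrite andbT.
  (* The new letter commutes with the tail of the chain below [i], turns by the braid relation into
     [t i] to the left of the segment i+1, i, and [t i] then commutes with the head. *)
  move=> M t [_ tC tB]; rewrite (@chain_cat _ _ i); [|lia..].
  rewrite (@chain_rcons m i) ?(@chain_rcons m i.+1); [|lia..].
  rewrite wprod_seq1 !wprod_cat !wprod_seq1 -!mulgA.
  rewrite -(@wprod_commute _ _ _ (t i.+1)) => [|a]; last first.
    by rewrite mem_rev mem_index_iota => ?; symmetry; apply: tC; lia.
  rewrite [RHS]mulgA (@wprod_commute _ _ _ _ (chain m i.+2)) => [|a]; last first.
    by rewrite mem_chain => ?; apply: tC; lia.
  by rewrite -!mulgA; congr (_ * _); rewrite !mulgA -tB.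
Qed.

(** Letters are absorbed one at a time from the right by [chain_step]. The witnesses are chosen
    before [M], so one normal form serves both for permutations and for an arbitrary monoid. *)
Lemma coxeter_normal_form m w : all (gtn m.+1) w ->
  exists u j, [/\ all (gtn m) u, j <= m.+1 &
    forall (M : monoidType) (t : nat -> M), coxeter m.+1 t ->
      wprod t w = wprod t u * wprod t (chain m j)].
Proof.
elim/last_ind: w => [|w i IH].
  by exists [::], m.+1; split=> // M t _; rewrite chain_nil !wprod_nil mulg1.
rewrite all_rcons => /andP[im /IH[u [j [um jm wE]]]].
have [v [j' [vm j'm E]]] := @chain_step m i j im jm.
exists (u ++ v), j'; split; rewrite ?all_cat ?um ?vm // => M t ct.
by rewrite -cats1 !wprod_cat wprod_seq1 wE // -!mulgA E.
Qed.

Variable n : nat.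

Definition pswap (i : nat) : {perm 'I_n} :=
  if insub i is Some k then swap k else 1.

Lemma pswap_ord (i : 'I_n.-1) : pswap i = swap i.
Proof. by rewrite /pswap valK. Qed.

Lemma pswapE i (x : 'I_n) : i < n.-1 ->
  pswap i x = (if x == i :> nat then i.+1 else if x == i.+1 :> nat then i else x)
    :> nat.
Proof.
move=> ilt; rewrite -[i]/(val (Ordinal ilt)) pswap_ord /=.
case: tpermP => [->|->|/eqP + /eqP].
- by rewrite /= eqxx.
- by rewrite /= eqxx gtn_eqF.
- by rewrite -!val_eqE /= => /negbTE -> /negbTE ->.
Qed.

Lemma coxeter_pswap : coxeter n.-1 pswap.
Proof.
split=> [i ilt|i j ij jlt|i ilt]; apply/permP => x; apply: val_inj;
  rewrite /= ?permM ?perm1; repeat (rewrite pswapE; last by lia);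
  repeat match goal with |- context [if ?a == ?b then _ else _] =>
    lazymatch a with
    | context [if _ then _ else _] => fail
    | _ => case: (a =P b) => ?
    end
  end; lia.
Qed.

Lemma pswap_fix m w (x : 'I_n) : m <= n.-1 -> all (gtn m) w -> m < x ->
  wprod pswap w x = x.
Proof.
move=> mn; elim: w => [|i w IH] /=; first by rewrite wprod_nil perm1.
move=> /andP[im wm] mx; rewrite wprod_cons permM.
suff -> : pswap i x = x by apply: IH.
by apply: val_inj; rewrite /= pswapE ?gtn_eqF //=; move: im => /=; lia.
Qed.

(** Permutations compose from left to right, so each letter of the chain lowers the point by one.
    Thus a coset representative is recognised by the image of m+1. *)
Lemma pswap_chain m j (x : 'I_n) : m < n.-1 -> j <= m.+1 -> x = m.+1 :> nat ->
  wprod pswap (chain m j) x = j :> nat.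
Proof.
elim: m x => [|m IH] x mn; rewrite leq_eqVlt => /predU1P[->|jm] xm.
- by rewrite chain_nil wprod_nil perm1.
- have -> : j = 0%N by lia.
  by rewrite [chain _ _]/= wprod_seq1 pswapE // xm.
- by rewrite chain_nil wprod_nil perm1.
- rewrite (@chain_cat _ _ m.+1) // (chain_rcons (leqnn _)) chain_nil.
  rewrite wprod_cat wprod_seq1 permM.
  by apply: IH => //; [lia | rewrite pswapE // xm eqxx gtn_eqF].
Qed.

(** The prefix of a normal form fixes m+1, so the image of m+1 determines the chain. Cancelling it
    in the permutation group leaves prefixes in fewer generators, to which induction applies. *)
Lemma coxeter_complete (M : monoidType) (t : nat -> M) m u v :
  m <= n.-1 -> coxeter m t -> all (gtn m) u -> all (gtn m) v ->
  wprod pswap u = wprod pswap v -> wprod t u = wprod t v.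
Proof.
elim: m u v => [|m IH] u v mn ct; first by case: u v => [|? ?] [|? ?].
move=> /coxeter_normal_form[u' [j [u'm jm uE]]].
move=> /coxeter_normal_form[v' [k [v'm km vE]]].
have cp := coxeterW mn coxeter_pswap; rewrite (uE _ _ cp) (vE _ _ cp) => E.
have mlt : m.+1 < n by lia.
have jk : j = k.
  rewrite -(@pswap_chain m j (Ordinal mlt)) // -(@pswap_chain m k (Ordinal mlt)) //.
  move/permP/(_ (Ordinal mlt)): E.
  by rewrite !permM (@pswap_fix m u') ?(@pswap_fix m v') ?(ltnW mn) //= => ->.
rewrite (uE _ _ ct) (vE _ _ ct) -jk; congr (_ * _).
apply: IH => //; first exact: ltnW.
  exact: coxeterW ct.
by apply: (mulIg (wprod pswap (chain m j))); rewrite E jk.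
Qed.

End Coxeter.

(** * Adjacent transpositions generate the symmetric group *)

Section SymmetricWords.
Variable n : nat.
Local Open Scope group_scope.
Implicit Types (x y : 'I_n) (s : {perm 'I_n}) (u : seq 'I_n.-1).

Lemma wprod_swap_rev u : wprod (@swap n) (rev u) = (wprod (@swap n) u)^-1.
Proof.
rewrite /wprod -[u in RHS]revK -prodgV; apply: eq_bigr => i _.
by rewrite /swap tpermV.
Qed.

Lemma tperm_word x y : exists u, wprod (@swap n) u = tperm x y.
Proof.
wlog xy : x y / x < y => [H|].
  have [/H //|yx|/val_inj ->] := ltngtP x y.
    by rewrite tpermC; apply: H.
  by exists [::]; rewrite wprod_nil tperm1.
case: y xy => y yn /= xy; elim: y yn xy => // y IH yn; rewrite ltnS => xy.
have yn1 : y < n.-1 by lia.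
have lo_y : lo (Ordinal yn1) = Ordinal (ltnW yn) by apply: val_inj.
have hi_y : hi (Ordinal yn1) = Ordinal yn by apply: val_inj.
move: xy; rewrite leq_eqVlt => /predU1P[xy|xy].
  exists [:: Ordinal yn1]; rewrite wprod_seq1 /swap lo_y hi_y.
  by congr tperm; apply: val_inj.
have [u uE] := IH (ltnW yn) xy.
(* Conjugating the transposition of x and y by the swap of y and y+1 gives that of x and y+1. *)
exists (Ordinal yn1 :: rcons u (Ordinal yn1)).
rewrite -cats1 wprod_cons wprod_cat wprod_seq1 uE /swap lo_y hi_y.
rewrite -{1}tpermV -/(conjg _ _) tpermJ tpermL tpermD //.
  by rewrite -val_eqE /=; lia.
by rewrite -val_eqE /=; lia.
Qed.

Lemma perm_word s : exists u, wprod (@swap n) u = s.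
Proof.
case: (prod_tpermP s) => ts -> _; elim: ts => [|[x y] ts [u uE]].
  by exists [::]; rewrite big_nil wprod_nil.
have [v vE] := tperm_word x y; exists (v ++ u).
by rewrite wprod_cat uE vE big_cons.
Qed.

End SymmetricWords.

Definition satisfies (G : Type) (rel : seq G -> seq G -> Prop) (M : monoidType)
    (g : G -> M) : Prop :=
  forall u v, rel u v -> wprod g u = wprod g v.

(** * Monoids satisfying the abacus relations *)

Section AbacusMonoid.
Variables (d n : nat) (M : monoidType) (g : abacus_generator n -> M).
Hypothesis gP : satisfies (@abacus_relation d n) g.
Local Open Scope group_scope.

Let s i := g (As i).
Let r i := g (Ar i).
Let o i := g (Ao i).

Lemma abacus_ssE i : s i * s i = 1.
Proof. by have := gP (abacus_ss d i); rewrite !wprod_cons !wprod_nil !mulg1. Qed.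

Lemma abacus_rrE i : r i * r i = r i.
Proof. by have := gP (abacus_rr d i); rewrite !wprod_cons !wprod_nil !mulg1. Qed.

Lemma abacus_r_commE i j : r i * r j = r j * r i.
Proof. by have := gP (abacus_r_comm d i j); rewrite !wprod_cons !wprod_nil !mulg1. Qed.

Lemma abacus_rsE j i : r j * s i = s i * r (swap i j).
Proof.
have rE := @gP [:: _; _] [:: _; _]; rewrite /swap; case: tpermP => [->|->|jlo jhi].
- by have := rE _ _ _ _ (abacus_rs_lo d i); rewrite !wprod_cons !wprod_nil !mulg1.
- by have := rE _ _ _ _ (abacus_rs_hi d i); rewrite !wprod_cons !wprod_nil !mulg1.
- by have := rE _ _ _ _ (abacus_rs_comm d jlo jhi);
    rewrite !wprod_cons !wprod_nil !mulg1.
Qed.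

Lemma abacus_rsrE i : r (lo i) * s i * r (lo i) = r (lo i) * r (hi i).
Proof.
by have := gP (abacus_rsr d i); rewrite !wprod_cons !wprod_nil !mulg1 mulgA.
Qed.

Lemma abacus_o_powE i : o i ^+ d = 1.
Proof.
have := gP (abacus_o_pow d i); rewrite wprod_nil => <-.
elim: d => [|k IH]; first by rewrite wprod_nil.
by rewrite expgS IH /= wprod_cons.
Qed.

Lemma abacus_o_commE i j : o i * o j = o j * o i.
Proof. by have := gP (abacus_o_comm d i j); rewrite !wprod_cons !wprod_nil !mulg1. Qed.

Lemma abacus_osE j i : o j * s i = s i * o (swap i j).
Proof. by have := gP (abacus_os d i j); rewrite !wprod_cons !wprod_nil !mulg1. Qed.

Lemma abacus_ro_commE i j : i <> j -> r i * o j = o j * r i.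
Proof.
by move=> /(abacus_ro_comm d)/gP; rewrite !wprod_cons !wprod_nil !mulg1.
Qed.

Lemma abacus_roE i : r i * o i = r i.
Proof. by have := gP (abacus_ro d i); rewrite !wprod_cons !wprod_nil !mulg1. Qed.

Lemma abacus_orE i : o i * r i = r i.
Proof. by have := gP (abacus_or d i); rewrite !wprod_cons !wprod_nil !mulg1. Qed.

(** The Coxeter presentation enters here: the [s]-part of a word may be replaced by any other word
    for the same permutation. *)
Lemma abacus_swap_word u v :
  wprod (@swap n) u = wprod (@swap n) v -> wprod s u = wprod s v.
Proof.
have wE (N : monoidType) (a : 'I_n.-1 -> N) (b : nat -> N) w :
    (forall i : 'I_n.-1, b i = a i) -> wprod a w = wprod b (map val w).
  by move=> ab; rewrite wprod_map; apply: eq_bigr => i _; rewrite /= ab.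
have vw (w : seq 'I_n.-1) : all (gtn n.-1) (map val w).
  by elim: w => //= i w ->; rewrite andbT.
rewrite !(wE _ _ _ _ (extend_ordE s)) !(wE _ _ _ _ (@pswap_ord n)).
apply: (@coxeter_complete _ _ _ n.-1) => //; apply: coxeter_extend_ord.
- exact: abacus_ssE.
- move=> i j ij; have := gP (abacus_s_comm d (or_introl ij)).
  by rewrite !wprod_cons !wprod_nil !mulg1.
- move=> i j ij; have := gP (abacus_s_braid d (or_introl ij)).
  by rewrite !wprod_cons !wprod_nil !mulg1 !mulgA.
Qed.

Lemma abacus_word_rev u : wprod s u * wprod s (rev u) = 1.
Proof.
rewrite -wprod_cat -(wprod_nil s); apply: abacus_swap_word.
by rewrite wprod_cat wprod_swap_rev mulgV wprod_nil.
Qed.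

Lemma abacus_r_word j u : r j * wprod s u = wprod s u * r (wprod (@swap n) u j).
Proof.
elim: u j => [|i u IH] j; first by rewrite !wprod_nil mulg1 mul1g perm1.
by rewrite !wprod_cons mulgA abacus_rsE -mulgA IH mulgA permM.
Qed.

Lemma abacus_sr j i : s i * r j = r (swap i j) * s i.
Proof. by rewrite abacus_rsE /swap tpermK. Qed.

Lemma abacus_so j i : s i * o j = o (swap i j) * s i.
Proof. by rewrite abacus_osE /swap tpermK. Qed.

Lemma abacus_s_wprod_r i l : s i * wprod r l = wprod r (map (swap i) l) * s i.
Proof.
elim: l => [|j l IH]; first by rewrite !wprod_nil mulg1 mul1g.
by rewrite /= !wprod_cons mulgA abacus_sr -!mulgA IH.
Qed.

Lemma abacus_s_wprod_o i l : s i * wprod o l = wprod o (map (swap i) l) * s i.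
Proof.
elim: l => [|j l IH]; first by rewrite !wprod_nil mulg1 mul1g.
by rewrite /= !wprod_cons mulgA abacus_so -!mulgA IH.
Qed.

Lemma abacus_r_wprod_r i l : r i * wprod r l = wprod r l * r i.
Proof. by apply: wprod_commute => j _; apply: abacus_r_commE. Qed.

Lemma abacus_wprod_r_mem i l : i \in l -> wprod r l * r i = wprod r l.
Proof.
elim: l => // j l IH; rewrite in_cons wprod_cons => /predU1P[->|/IH il].
  by rewrite -mulgA -abacus_r_wprod_r mulgA abacus_rrE.
by rewrite -mulgA il.
Qed.

Lemma abacus_wprod_r_o i l : i \in l -> wprod r l * o i = wprod r l.
Proof. by move=> /abacus_wprod_r_mem <-; rewrite -mulgA abacus_roE. Qed.

Lemma abacus_o_wprod_r i l : i \in l -> o i * wprod r l = wprod r l.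
Proof.
move=> /abacus_wprod_r_mem <-.
by rewrite -abacus_r_wprod_r mulgA abacus_orE.
Qed.

Lemma abacus_o_wprod_r_comm i l : i \notin l -> o i * wprod r l = wprod r l * o i.
Proof.
move=> il; apply: wprod_commute => j jl; symmetry; apply: abacus_ro_commE => ji.
by rewrite -ji jl in il.
Qed.

Lemma abacus_wprod_r_sub l l' :
  {subset l' <= l} -> wprod r l * wprod r l' = wprod r l.
Proof.
elim: l' => [|j l' IH] sub; first by rewrite wprod_nil mulg1.
rewrite wprod_cons mulgA abacus_wprod_r_mem ?sub ?mem_head // IH // => i il.
by rewrite sub // in_cons il orbT.
Qed.

(** Each of the two products absorbs the other, and they commute; hence only the set of removed
    points matters. *)
Lemma abacus_wprod_r_eq l l' : l =i l' -> wprod r l = wprod r l'.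
Proof.
move=> ll'; rewrite -(@abacus_wprod_r_sub l l') => [|i]; last by rewrite ll'.
rewrite wprod_commute => [|j _]; last by rewrite abacus_r_wprod_r.
by rewrite abacus_wprod_r_sub // => i; rewrite ll'.
Qed.

Lemma abacus_wprod_r_filter l a :
  wprod r l * wprod o a = wprod r l * wprod o [seq i <- a | i \notin l].
Proof.
elim: a => [|i a IH] //=; case: ifPn => [il|/negbNE il].
  rewrite !wprod_cons !mulgA -(abacus_o_wprod_r_comm il) -!mulgA.
  by rewrite IH.
by rewrite wprod_cons mulgA abacus_wprod_r_o.
Qed.

Lemma abacus_o_prod (e : seq 'I_n) (c : 'I_n -> nat) j : uniq e -> j \in e ->
  o j * \prod_(i <- e) o i ^+ c i = \prod_(i <- e) o i ^+ ((i == j) + c i).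
Proof.
elim: e => // k e IH /= /andP[ke ue]; rewrite in_cons !big_cons.
have [-> _|kj /= je] := eqVneq j k.
  rewrite mulgA -expgS; congr (_ * _).
  apply: eq_big_seq => i ie; case: eqP => // ik; by rewrite -ik ie in ke.
rewrite add0n -IH // !mulgA; congr (_ * _).
by apply: commuteX; apply: abacus_o_commE.
Qed.

Lemma abacus_wprod_o_count a :
  wprod o a = \prod_(i <- enum 'I_n) o i ^+ count_mem i a.
Proof.
elim: a => [|j a IH].
  by rewrite wprod_nil big1 // => i _; rewrite expg0.
rewrite wprod_cons IH abacus_o_prod ?enum_uniq ?mem_enum //.
by apply: eq_bigr => i _ /=; rewrite eq_sym.
Qed.

Lemma abacus_wprod_o_eq a b :
  (forall i, count_mem i a = count_mem i b %[mod d]) -> wprod o a = wprod o b.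
Proof.
move=> ab; rewrite !abacus_wprod_o_count; apply: eq_bigr => i _.
have oE k : o i ^+ k = o i ^+ (k %% d).
  by rewrite {1}(divn_eq k d) expgnDr mulnC expgnA abacus_o_powE expg1n mul1g.
by rewrite oE ab -oE.
Qed.

(* Conjugation reduces to x = lo i, y = hi i, where
   r_x r_y s_i = r_x s_i r_x s_i = r_x s_i s_i r_y = r_x r_y. *)
Lemma abacus_rr_tperm x y u : x != y -> wprod (@swap n) u = tperm x y ->
  r x * r y * wprod s u = r x * r y.
Proof.
move=> xy uE.
have n1 : 0 < n.-1.
  have : x != y :> nat by []. 
  by case: (x) (y) => [a alt] [b blt] /=; lia.
pose i := Ordinal n1.
(* The first transposition takes x to [lo i]; the second takes the resulting image of y to [hi i]
   and leaves [lo i] in place. *)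
have [c cE] := perm_word (tperm x (lo i) * tperm (tperm x (lo i) y) (hi i)).
have cx : wprod (@swap n) c x = lo i.
  rewrite cE permM tpermL tpermD //.
  by rewrite -[X in _ != X](tpermL x (lo i)) (inj_eq perm_inj) eq_sym.
have cy : wprod (@swap n) c y = hi i by rewrite cE permM tpermL.
have -> : wprod s u = wprod s (c ++ i :: rev c).
  apply: abacus_swap_word; rewrite uE wprod_cat wprod_cons wprod_swap_rev.
  by rewrite -{1}(invgK (wprod _ c)) -/(conjg _ _) /swap -cx -cy tpermJ !permK.
have rrs : r (lo i) * r (hi i) * s i = r (lo i) * r (hi i).
  rewrite -abacus_rsrE -!mulgA abacus_rsE (mulgA (s i) (s i)) abacus_ssE mul1g.
  by rewrite /swap tpermL mulgA abacus_rsrE.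
have rrc : r x * r y * wprod s c = wprod s c * (r (lo i) * r (hi i)).
  by rewrite -mulgA abacus_r_word cy mulgA abacus_r_word cx -mulgA.
rewrite wprod_cat wprod_cons !mulgA rrc -(mulgA _ _ (s i)) rrs -rrc -mulgA.
by rewrite abacus_word_rev mulg1.
Qed.

(** Induction on [l = x :: l']. If u fixes x, its support already lies in l'. Otherwise, with y the
    image of x, following u by the transposition of x and y gives a permutation supported in l', and
    that transposition is absorbed by [r x * r y]. *)
Lemma abacus_wprod_r_fix l u : (forall i, i \notin l -> wprod (@swap n) u i = i) ->
  wprod r l * wprod s u = wprod r l.
Proof.
elim: l u => [|x l IH] u ufix.
  have -> : wprod s u = wprod s [::].
    apply: abacus_swap_word; rewrite wprod_nil; apply/permP => i.
    by rewrite perm1 ufix.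
  by rewrite !wprod_nil mulg1.
have fixx : wprod (@swap n) u x = x ->
    wprod r (x :: l) * wprod s u = wprod r (x :: l).
  move=> ux; rewrite wprod_cons -mulgA IH // => i il.
  by have [->//|ix] := eqVneq i x; apply: ufix; rewrite in_cons negb_or ix.
have [/fixx//|uxx] := eqVneq (wprod (@swap n) u x) x.
set y := wprod (@swap n) u x in uxx *.
have yl : y \in l.
  (* A point y outside the list would be fixed by u, so u would take both x and y to y. *)
  have : y \in x :: l.
    by apply: contraR uxx => /ufix; rewrite {2}/y => /perm_inj ->.
  by rewrite in_cons (negbTE uxx).
have [v vE] := tperm_word x y.
have vv : wprod s v * wprod s v = 1.
  rewrite -wprod_cat -(wprod_nil s); apply: abacus_swap_word.
  by rewrite wprod_cat vE tperm2 wprod_nil.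
have uvE : wprod r l * wprod s (u ++ v) = wprod r l.
  apply: IH => i il; rewrite wprod_cat vE permM.
  have [->|ix] := eqVneq i x; first by rewrite -/y tpermR.
  rewrite ufix ?in_cons ?negb_or ?ix // tpermD //; first by rewrite eq_sym.
  by apply: contraNneq il => <-.
have rlE : wprod r (x :: l) = wprod r l * (r x * r y).
  by rewrite wprod_cons mulgA -abacus_r_wprod_r -mulgA abacus_wprod_r_mem.
have rlv : wprod r (x :: l) * wprod s v = wprod r (x :: l).
  by rewrite rlE -mulgA abacus_rr_tperm // eq_sym.
rewrite -[LHS]mulg1 -vv mulgA -(mulgA _ (wprod s u)) -wprod_cat.
by rewrite {1}wprod_cons -(mulgA (r x)) uvE -wprod_cons rlv.
Qed.

(** The word [u ++ rev v] fixes every point off [l], so it can be inserted before [v], where [rev v]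
    and [v] cancel. *)
Lemma abacus_wprod_r_agree l u v :
  (forall i, i \notin l -> wprod (@swap n) u i = wprod (@swap n) v i) ->
  wprod r l * wprod s u = wprod r l * wprod s v.
Proof.
move=> uv; rewrite -[in RHS](@abacus_wprod_r_fix l (u ++ rev v)) => [|i il].
  have := abacus_word_rev (rev v); rewrite revK => vv.
  by rewrite wprod_cat -!mulgA vv mulg1.
by rewrite wprod_cat wprod_swap_rev permM uv // permK.
Qed.

Lemma abacus_wprod_ro_comm l a : (forall i, i \in a -> i \notin l) ->
  wprod r l * wprod o a = wprod o a * wprod r l.
Proof.
move=> al; apply: wprod_commute => i ia; symmetry.
by apply: abacus_o_wprod_r_comm; apply: al.
Qed.

End AbacusMonoid.

(** * Rook diagrams *)

Section AbacusRook.
Variables d n : nat.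
Local Open Scope group_scope.
Implicit Types i : 'I_n.

Lemma rook_mulE (a b : abacus_rook d n) i : (a * b) i =
  if a i is Some (j, x) then
    if b j is Some (k, y) then Some (k, (x + y)%R) else None
  else None.
Proof. by rewrite ffunE. Qed.

Lemma rook_oneE i : (1 : abacus_rook d n) i = Some (i, 0%R).
Proof. by rewrite ffunE perm1. Qed.

Lemma perm_rookM (s t : {perm 'I_n}) :
  perm_rook d (s * t) = perm_rook d s * perm_rook d t.
Proof.
by apply: abacus_rookP => i; rewrite rook_mulE !ffunE permM GRing.addr0.
Qed.

Lemma wprod_rook_s (u : seq 'I_n.-1) :
  wprod (@rook_s d n) u = perm_rook d (wprod (@swap n) u).
Proof.
elim: u => [|i u IH]; first by rewrite !wprod_nil.
by rewrite !wprod_cons perm_rookM IH.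
Qed.

Lemma wprod_rook_r (l : seq 'I_n) i :
  wprod (@rook_r d n) l i = if i \in l then None else Some (i, 0%R).
Proof.
elim: l => [|j l IH]; first by rewrite wprod_nil rook_oneE.
rewrite wprod_cons rook_mulE ffunE in_cons; case: (i == j) => //=.
by rewrite IH; case: ifP => // _; rewrite GRing.addr0.
Qed.

Lemma beads_add p q : (inZp p + inZp q)%R = inZp (p + q) :> beads d.
Proof. by apply: val_inj; rewrite /= modnDm. Qed.

Lemma beads0 : 0%R = inZp 0 :> beads d.
Proof. by apply: val_inj; rewrite /= mod0n. Qed.

Lemma wprod_rook_o (l : seq 'I_n) i :
  wprod (@rook_o d n) l i = Some (i, inZp (count_mem i l)).
Proof.
elim: l => [|j l IH]; first by rewrite wprod_nil rook_oneE beads0.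
rewrite wprod_cons rook_mulE ffunE IH /= eq_sym.
by case: (j == i); rewrite ?beads0 beads_add.
Qed.

Definition abacus_word (l a : seq 'I_n) (u : seq 'I_n.-1) :
    seq (abacus_generator n) :=
  map (@Ar n) l ++ map (@Ao n) a ++ map (@As n) u.

Lemma wprod_abacus_word (M : monoidType) (g : abacus_generator n -> M) l a u :
  wprod g (abacus_word l a u) =
  wprod (g \o @Ar n) l * (wprod (g \o @Ao n) a * wprod (g \o @As n) u).
Proof. by rewrite !wprod_cat !wprod_map. Qed.

(** This shows what a diagram remembers of a normal form: the set [l] and, off [l], the permutation
    and the bead counts reduced to bead labels. *)
Lemma abacus_word_rook l a u i :
  wprod (@abacus_generator_val d n) (abacus_word l a u) i =
  if i \in l then None
  else Some (wprod (@swap n) u i, inZp (count_mem i a)).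
Proof.
rewrite wprod_abacus_word rook_mulE wprod_rook_r; case: ifP => // _.
rewrite rook_mulE wprod_rook_o wprod_rook_s ffunE.
by rewrite !beads0 !beads_add addn0.
Qed.

(** Generators are prepended one by one: an [s] relabels the [r]'s and [o]'s it crosses, an [r]
    joins [l], an [o] is absorbed by [l] or commutes with it. The lists do not depend on [M], so
    diagrams and any other model share them. *)
Lemma abacus_normal_form (w : seq (abacus_generator n)) :
  exists l a u, forall (M : monoidType) (g : abacus_generator n -> M),
    satisfies (@abacus_relation d n) g -> wprod g w = wprod g (abacus_word l a u).
Proof.
elim: w => [|x w [l [a [u E]]]].
  by exists [::], [::], [::].
case: x => i.
- exists (map (swap i) l), (map (swap i) a), (i :: u) => M g gP.
  rewrite wprod_cons E // !wprod_abacus_word wprod_cons /=.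
  rewrite mulgA (abacus_s_wprod_r gP) -mulgA (mulgA (g (As i))).
  by rewrite (abacus_s_wprod_o gP) -!mulgA.
- exists (i :: l), a, u => M g gP.
  by rewrite wprod_cons E // !wprod_abacus_word wprod_cons -!mulgA.
- have [il|il] := boolP (i \in l).
    exists l, a, u => M g gP; rewrite wprod_cons E // wprod_abacus_word mulgA.
    by rewrite (abacus_o_wprod_r gP).
  exists l, (i :: a), u => M g gP.
  rewrite wprod_cons E // !wprod_abacus_word wprod_cons !mulgA.
  by rewrite (abacus_o_wprod_r_comm gP).
Qed.

Lemma swap_comm (i j : 'I_n.-1) : i.+1 < j \/ j.+1 < i ->
  swap i * swap j = swap j * swap i.
Proof.
have [_ C _] := coxeter_pswap n.
by rewrite -!pswap_ord => -[|] ij; [|symmetry]; apply: C.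
Qed.

Lemma swap_braid (i j : 'I_n.-1) : j = i.+1 :> nat \/ i = j.+1 :> nat ->
  swap i * swap j * swap i = swap j * swap i * swap j.
Proof.
have [_ _ B] := coxeter_pswap n.
rewrite -!pswap_ord => -[ij|ij]; rewrite ij; [|symmetry]; apply: B;
  by rewrite -ij.
Qed.

Lemma rook_ss (i : 'I_n.-1) : rook_s d i * rook_s d i = 1.
Proof. by rewrite -perm_rookM /swap tperm2. Qed.

Lemma rook_s_comm (i j : 'I_n.-1) : i.+1 < j \/ j.+1 < i ->
  rook_s d i * rook_s d j = rook_s d j * rook_s d i.
Proof. by move=> ij; rewrite -!perm_rookM swap_comm. Qed.

Lemma rook_s_braid (i j : 'I_n.-1) : j = i.+1 :> nat \/ i = j.+1 :> nat ->
  rook_s d i * (rook_s d j * rook_s d i) = rook_s d j * (rook_s d i * rook_s d j).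
Proof. by move=> ij; rewrite -!perm_rookM !mulgA swap_braid. Qed.

Lemma rook_rs (j : 'I_n) (i : 'I_n.-1) :
  rook_r d j * rook_s d i = rook_s d i * rook_r d (swap i j).
Proof.
apply: abacus_rookP => x; rewrite !rook_mulE !ffunE (inj_eq perm_inj).
by case: (x == j); rewrite // ffunE.
Qed.

Lemma rook_os (j : 'I_n) (i : 'I_n.-1) :
  rook_o d j * rook_s d i = rook_s d i * rook_o d (swap i j).
Proof.
apply: abacus_rookP => x; rewrite !rook_mulE !ffunE (inj_eq perm_inj).
by rewrite GRing.addr0 GRing.add0r.
Qed.

Lemma rook_rr (i j : 'I_n) x : (rook_r d i * rook_r d j) x =
  if (x == i) || (x == j) then None else Some (x, 0%R).
Proof.
rewrite rook_mulE ffunE; case: (x == i) => //=; rewrite ffunE.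
by case: (x == j); rewrite // GRing.addr0.
Qed.

Lemma rook_rsr (i : 'I_n.-1) :
  rook_r d (lo i) * (rook_s d i * rook_r d (lo i)) = rook_r d (lo i) * rook_r d (hi i).
Proof.
rewrite mulgA rook_rs -mulgA /swap tpermL; apply: abacus_rookP => x.
have sE : rook_s d i x = Some (tperm (lo i) (hi i) x, 0%R) by rewrite ffunE.
rewrite [LHS]rook_mulE sE !rook_rr (inv_eq (@tpermK _ _ _)) tpermR.
rewrite (inv_eq (@tpermK _ _ _)) tpermL orbC.
case: ifPn => //; rewrite negb_or => /andP[xlo xhi].
by rewrite GRing.addr0 tpermD // eq_sym.
Qed.

Lemma rook_ro (i j : 'I_n) : rook_r d i * rook_o d j =
  if i == j then rook_r d i else rook_o d j * rook_r d i.
Proof.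
apply: abacus_rookP => x; rewrite (fun_if (fun f : abacus_rook d n => f x)).
rewrite !rook_mulE !ffunE; have [->|ij] := eqVneq i j.
  by case: ifPn => // xj; rewrite ffunE (negbTE xj) GRing.addr0.
by case: ifPn => // xi; rewrite ffunE GRing.addr0 GRing.add0r.
Qed.

Lemma rook_or (i : 'I_n) : rook_o d i * rook_r d i = rook_r d i.
Proof.
apply: abacus_rookP => x; rewrite rook_mulE !ffunE.
by case: ifPn => // xi; rewrite GRing.addr0.
Qed.

Lemma rook_o_pow (i : 'I_n) : wprod (@rook_o d n) (nseq d i) = 1.
Proof.
apply: abacus_rookP => x; rewrite wprod_rook_o rook_oneE count_nseq beads0.
congr (Some (_, _)); apply: val_inj => /=.
(* The modulus of [beads d] is [d.-1.+1], which is [d] for positive [d]; for [d = 0] the word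
   [nseq d i] is empty. *)
by case: d => [|k]; rewrite ?muln0 //= modnMl mod0n.
Qed.

Lemma rook_o_comm (i j : 'I_n) :
  rook_o d i * rook_o d j = rook_o d j * rook_o d i.
Proof.
by apply: abacus_rookP => x; rewrite !rook_mulE !ffunE GRing.addrC.
Qed.

Lemma val_satisfies :
  satisfies (@abacus_relation d n) (@abacus_generator_val d n).
Proof.
move=> u v [] *; rewrite ?wprod_cons ?wprod_nil ?mulg1 /=.
- exact: rook_ss.
- exact: rook_s_comm.
- exact: rook_s_braid.
- by apply: abacus_rookP => x; rewrite rook_rr ffunE orbb.
- by apply: abacus_rookP => x; rewrite !rook_rr orbC.
- by rewrite rook_rs /swap tpermD //; apply/eqP => ?; auto.
- by rewrite rook_rs /swap tpermL.
- by rewrite rook_rs /swap tpermR.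
- exact: rook_rsr.
- by rewrite -map_nseq wprod_map; apply: rook_o_pow.
- exact: rook_o_comm.
- exact: rook_os.
- by rewrite rook_ro; case: eqP.
- by rewrite rook_ro eqxx.
- exact: rook_or.
Qed.

Lemma abacus_complete (d_ge1 : 0 < d) (M : monoidType)
    (g : abacus_generator n -> M) v w :
  satisfies (@abacus_relation d n) g ->
  wprod (@abacus_generator_val d n) v = wprod (@abacus_generator_val d n) w ->
  wprod g v = wprod g w.
Proof.
move=> gP.
have [l [a [u E]]] := abacus_normal_form v.
have [l' [a' [u' E']]] := abacus_normal_form w.
rewrite (E _ _ val_satisfies) (E' _ _ val_satisfies) (E _ _ gP) (E' _ _ gP).
move=> rookE; have {}rookE i := congr1 (fun f : abacus_rook d n => f i) rookE.
have ll' : l =i l'.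
  by move=> i; move: (rookE i); rewrite !abacus_word_rook; do 2!case: ifP.
have offl i : i \notin l -> wprod (@swap n) u i = wprod (@swap n) u' i /\
    count_mem i a = count_mem i a' %[mod d].
  move=> il; move: (rookE i); rewrite !abacus_word_rook -ll' (negbTE il).
  (* Bead labels are compared modulo [d.-1.+1], which equals [d] because [d] is positive. *)
  by case=> -> aa; split=> //; move: aa; rewrite prednK.
rewrite !wprod_abacus_word -(abacus_wprod_r_eq gP ll') !mulgA.
rewrite (abacus_wprod_r_filter gP) [in RHS](abacus_wprod_r_filter gP).
have offP (b : seq 'I_n) i : i \in [seq i <- b | i \notin l] -> i \notin l.
  by rewrite mem_filter => /andP[].
(* The remaining [o]'s lie off [l], so they move to the front; the [r]'s then stand next to the
   [s]'s and the two factors are compared separately. *)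
rewrite !(abacus_wprod_ro_comm gP (@offP _)) -!mulgA; congr (_ * _).
  apply: (abacus_wprod_o_eq gP) => i; rewrite !count_filter.
  have [il|il] := boolP (i \in l).
    by rewrite !(@eq_count _ (predI _ _) pred0) ?count_pred0 // => j /=;
      case: eqP => // ->; rewrite il.
  have [_ ai] := offl i il.
  by rewrite !(@eq_count _ (predI _ _) (pred1 i)) // => j /=;
    case: eqP => // ->; rewrite il.
by apply: (abacus_wprod_r_agree gP) => i /offl[].
Qed.

End AbacusRook.

(** * A criterion for a monoid to have a given presentation *)

Section Presentations.
Local Open Scope group_scope.
Variables (G : choiceType) (rel : seq G -> seq G -> Prop).

Lemma wprod_congruence (M : monoidType) (g : G -> M) u v :
  satisfies rel g -> congruence rel u v -> wprod g u = wprod g v.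
Proof.
move=> gP; elim=> {u v} [u v /gP //|//|u v _ -> //|u v w _ -> _ -> //|].
by move=> u u' v v' _ uu' _ vv'; rewrite !wprod_cat uu' vv'.
Qed.

Lemma wprod_presented_gen w : wprod (presented_gen rel) w = word_class rel w.
Proof.
elim: w => [|a w IH]; first by rewrite wprod_nil.
by rewrite wprod_cons IH [LHS]presented_mulE.
Qed.

Lemma presented_gen_satisfies : satisfies rel (presented_gen rel).
Proof.
by move=> u v uv; rewrite !wprod_presented_gen; apply/word_classP/congruence_rel.
Qed.

(** Evaluation of a representative word is well defined because the relations hold, injective
    because equal values force equal classes, and surjective because the generators generate. *)
Lemma has_presentation_complete (M : monoidType) (g : G -> M) :
  satisfies rel g ->
  (forall u v, wprod g u = wprod g v ->
    wprod (presented_gen rel) u = wprod (presented_gen rel) v) ->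
  (forall x, exists w, wprod g w = x) ->
  has_presentation g rel.
Proof.
move=> gP inj surj; pose f (x : presented rel) := wprod g (repr x).
have fE w : f (word_class rel w) = wprod g w.
  by apply: wprod_congruence => //; apply/word_classP/word_class_repr.
exists f; split=> [|a]; last by rewrite fE wprod_seq1.
split.
  split=> [|x y]; first by rewrite fE wprod_nil.
  by rewrite fE wprod_cat.
exists (fun x => word_class rel (sval (cid (surj x)))) => x.
  case: cid => w /= wE; rewrite -(word_class_repr x) -!wprod_presented_gen.
  exact: inj.
by rewrite fE; case: cid.
Qed.

End Presentations.

(** * Framed rook monoids *)

Section ConjugateIdempotents.
Local Open Scope group_scope.
Variables (M : monoidType) (m : nat) (t r : nat -> M) (p1 : M).
Hypothesis rS : forall k, r k.+1 = t k * r k * t k.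
Hypothesis ct : coxeter m t.
Hypothesis r0t : forall i, 0 < i -> i < m -> r 0%N * t i = t i * r 0%N.

Let tt i : i < m -> t i * t i = 1. Proof. by case: ct => H _ _; apply: H. Qed.

Let tC i j : i.+1 < j -> j < m -> t i * t j = t j * t i.
Proof. by case: ct => _ H _; apply: H. Qed.

Let tB i : i.+1 < m -> t i * t i.+1 * t i = t i.+1 * t i * t i.+1.
Proof. by case: ct => _ _ H; apply: H. Qed.

Lemma conj_idem_lo i : i < m -> r i * t i = t i * r i.+1.
Proof. by move=> im; rewrite rS !mulgA tt // mul1g. Qed.

Lemma conj_idem_hi i : i < m -> r i.+1 * t i = t i * r i.
Proof. by move=> im; rewrite rS -!mulgA tt // mulg1. Qed.

(** Strong induction on j through r_j = t_(j-1) r_(j-1) t_(j-1): the letter t_i commutes with each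
    factor, except when i = j-2. *)
Lemma conj_idem_comm j i : j <= m -> i < m -> j != i -> j != i.+1 ->
  r j * t i = t i * r j.
Proof.
elim/ltn_ind: j i => -[|j] IH i jm im ji ji1.
  by apply: r0t => //; lia.
have [ij|ji'] := ltnP i j; last first.
  have c1 : t j * t i = t i * t j by apply: tC; lia.
  have c2 : r j * t i = t i * r j by apply: IH; lia.
  by rewrite rS -!mulgA c1 (mulgA (r j)) c2 !mulgA c1.
case: j => [|j] in IH jm ji ji1 ij *; first by [].
have [->|ij'] := eqVneq i j; last first.
  have c1 : t j.+1 * t i = t i * t j.+1 by symmetry; apply: tC; lia.
  have c2 : r j.+1 * t i = t i * r j.+1 by apply: IH; lia.
  rewrite (rS j.+1) -!mulgA c1 (mulgA (r j.+1)) c2.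
  by rewrite !mulgA c1.
(* Remaining case: in t_(j+1) t_j r_j t_j t_(j+1), the braid relation is applied on both sides of
   r_j, which commutes with t_(j+1). *)
have rj : r j * t j.+1 = t j.+1 * r j by apply: IH; lia.
rewrite !rS -!mulgA.
have -> : t j * (t j.+1 * t j) = t j.+1 * (t j * t j.+1) by rewrite !mulgA tB.
rewrite (mulgA (r j) (t j.+1)) rj -!mulgA.
suff tBx x : t j.+1 * (t j * (t j.+1 * x)) = t j * (t j.+1 * (t j * x)) by [].
by rewrite !mulgA tB.
Qed.

Hypothesis r0r0 : r 0%N * r 0%N = r 0%N.

Lemma conj_idemM k : k <= m -> r k * r k = r k.
Proof.
elim: k => [|k IH] km //.
rewrite rS -!mulgA (mulgA (t k) (t k)) tt // mul1g (mulgA (r k) (r k)) IH //.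
exact: ltnW.
Qed.

Hypothesis r0tr0 : 0 < m -> r 0%N * t 0%N * r 0%N = p1.
Hypothesis p1t : 0 < m -> p1 * t 0%N = p1.
Hypothesis tp1 : 0 < m -> t 0%N * p1 = p1.

Lemma conj_idem01 : 0 < m -> r 0%N * r 1%N = p1.
Proof. by move=> m0; rewrite rS !mulgA r0tr0 // p1t. Qed.

Lemma conj_idem10 : 0 < m -> r 1%N * r 0%N = p1.
Proof. by move=> m0; rewrite rS -!mulgA (mulgA (r 0%N)) r0tr0 // tp1. Qed.

(** The pair (0,1) holds since both products equal [p1]. Conjugation raises the second index, then
    the first, each time by a letter commuting with the other idempotent. *)
Lemma conj_idemC i j : i <= m -> j <= m -> r i * r j = r j * r i.
Proof.
wlog ij : i j / i < j => [H im jm|].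
  by have [/H-> //|/H-> //|-> //] := ltngtP i j.
elim: i j ij => [|i IH] j ij im jm.
  elim: j ij jm => // -[|j] IH _ jm; first by rewrite conj_idem01 // conj_idem10.
  have c0 : r 0%N * t j.+1 = t j.+1 * r 0%N by apply: conj_idem_comm; lia.
  rewrite (rS j.+1) !mulgA c0.
  rewrite -(mulgA _ (r 0%N)) IH //; last exact: ltnW.
  by rewrite -!mulgA c0.
have cj : r j * t i = t i * r j by apply: conj_idem_comm; lia.
rewrite rS -!mulgA -cj (mulgA (r i)) IH //; [|lia..].
by rewrite -!mulgA !mulgA cj.
Qed.

(* Conjugation by c = t_(i+1) t_i carries the case i to the case i+1. *)
Lemma conj_idem_rsr i : i < m -> r i * t i * r i = r i * r i.+1.
Proof.
elim: i => [|i IH] im; first by rewrite conj_idem01 // r0tr0.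
have im' := ltnW im; set c := t i.+1 * t i.
have rc : r i * c = c * r i.+1.
  by rewrite /c mulgA conj_idem_comm; [rewrite -!mulgA conj_idem_lo | lia..].
have rc1 : r i.+1 * c = c * r i.+2.
  rewrite /c mulgA conj_idem_lo // -!mulgA; congr (_ * _).
  by rewrite conj_idem_comm //; lia.
have tc : t i * c = c * t i.+1 by rewrite /c mulgA tB.
have cV : t i * t i.+1 * c = 1.
  by rewrite /c -!mulgA (mulgA (t i.+1)) tt // mul1g tt.
clearbody c.
have lE : c * (r i.+1 * t i.+1 * r i.+1) = r i * t i * r i * c.
  by rewrite !mulgA -rc -(mulgA _ c) -tc mulgA -(mulgA _ c) -rc mulgA.
have rE : c * (r i.+1 * r i.+2) = r i * r i.+1 * c.
  by rewrite mulgA -rc -mulgA -rc1 mulgA.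
by rewrite -[LHS]mul1g -[RHS]mul1g -cV -!(mulgA _ c) lE rE IH.
Qed.

Lemma conj_idem_prod_idem k : k <= m ->
  wprod r (iota 0 k) * wprod r (iota 0 k) = wprod r (iota 0 k).
Proof.
elim: k => [|k IH] km; first by rewrite wprod_nil mulg1.
rewrite -addn1 iotaD wprod_cat wprod_seq1 add0n -!mulgA (mulgA (r k)).
rewrite wprod_commute => [|j]; last by rewrite mem_iota => ?; apply: conj_idemC; lia.
by rewrite -mulgA conj_idemM ?(ltnW km) // mulgA IH // ltnW.
Qed.

(** The products r_0 ... r_k obey the recursion that the framed relations impose on the [p]'s. The
    factors before r_k commute with t_k and r_k and collapse by idempotence, which leaves
    [conj_idem_rsr]. *)
Lemma conj_idem_prod_step k : k < m ->
  wprod r (iota 0 k.+1) * t k * wprod r (iota 0 k.+1) = wprod r (iota 0 k.+2).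
Proof.
move=> km; have iS j : iota 0 j.+1 = iota 0 j ++ [:: j] by rewrite -addn1 iotaD.
rewrite !iS !wprod_cat !wprod_seq1; set R := wprod r (iota 0 k).
have Rr : r k * R = R * r k.
  by apply: wprod_commute => j; rewrite mem_iota => ?; apply: conj_idemC; lia.
have Rt : t k * R = R * t k.
  apply: wprod_commute => j; rewrite mem_iota => ?; symmetry.
  by apply: conj_idem_comm; lia.
rewrite -!mulgA (mulgA (t k)) Rt -(mulgA R) (mulgA (r k)) Rr -(mulgA R) mulgA.
by rewrite conj_idem_prod_idem ?(ltnW km) // (mulgA (r k)) conj_idem_rsr.
Qed.

End ConjugateIdempotents.

(** * The abacus relations in a monoid satisfying the framed relations *)

Section FramedMonoid.
Variables (d n : nat) (M : monoidType) (g : framed_generator n -> M).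
Hypothesis gP : satisfies (@framed_relation d n) g.
Local Open Scope group_scope.

Let s i := g (Fs i).
Let p i := g (Fp i).
Let z i := g (Fz i).

Let t : nat -> M := extend_ord s.

(** The images of the [r]'s, built from the first [p] by conjugation. Outside the index ranges [t]
    and [extend_ord p] take the default value 1. *)
Fixpoint framed_r (k : nat) : M :=
  if k is k'.+1 then t k' * framed_r k' * t k' else extend_ord p 0.

Definition framed_abacus_gen (a : abacus_generator n) : M :=
  match a with As i => s i | Ar i => framed_r i | Ao i => z i end.

Let relE u v : framed_relation d u v -> wprod g u = wprod g v := @gP u v.

Let coxeter_t : coxeter n.-1 t.
Proof.
apply: coxeter_extend_ord => [i|i j ij|i j ij].
- by have := relE (framed_ss d i); rewrite !wprod_cons !wprod_nil !mulg1.
- by have := relE (framed_s_comm d (or_introl ij));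
    rewrite !wprod_cons !wprod_nil !mulg1.
- by have := relE (framed_s_braid d (or_introl ij));
    rewrite !wprod_cons !wprod_nil !mulg1 !mulgA.
Qed.

Let rS k : framed_r k.+1 = t k * framed_r k * t k. Proof. by []. Qed.

Let r0E (i : 'I_n) : i = 0 :> nat -> framed_r 0 = p i.
Proof. by move=> i0; rewrite /= -i0 extend_ordE. Qed.

Let r0r0 : 0 < n -> framed_r 0 * framed_r 0 = framed_r 0.
Proof.
move=> n0; rewrite (@r0E (Ordinal n0)) //.
by have := relE (framed_pp d (Ordinal n0)); rewrite !wprod_cons !wprod_nil !mulg1.
Qed.

Let r0t i : 0 < i -> i < n.-1 -> framed_r 0 * t i = t i * framed_r 0.
Proof.
move=> i0 im; have n0 : 0 < n by lia.
rewrite (@r0E (Ordinal n0)) // /t (extend_ordE s (Ordinal im)).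
by have := relE (@framed_ps_comm d n (Ordinal n0) (Ordinal im) i0);
  rewrite !wprod_cons !wprod_nil !mulg1.
Qed.

Let pS (i : 'I_n.-1) : p (lo i) * s i * p (lo i) = p (hi i).
Proof.
by have := relE (framed_psp d i); rewrite !wprod_cons !wprod_nil !mulg1 mulgA.
Qed.

Let p1 := extend_ord p 1.

Let p1E (i : 'I_n.-1) : i = 0 :> nat -> p1 = p (hi i).
Proof. by move=> i0; rewrite /p1 -(extend_ordE p (hi i)) /= i0. Qed.

Let r0tr0 : 0 < n.-1 -> framed_r 0 * t 0%N * framed_r 0 = p1.
Proof.
move=> m0; rewrite (@p1E (Ordinal m0)) // -pS (@r0E (lo (Ordinal m0))) //.
by rewrite /t (extend_ordE s (Ordinal m0)).
Qed.

Let p1t : 0 < n.-1 -> p1 * t 0%N = p1.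
Proof.
move=> m0; rewrite (@p1E (Ordinal m0)) // /t (extend_ordE s (Ordinal m0)).
have := relE (@framed_ps d n (hi (Ordinal m0)) (Ordinal m0) (leqnn _)).
by rewrite !wprod_cons !wprod_nil !mulg1.
Qed.

Let tp1 : 0 < n.-1 -> t 0%N * p1 = p1.
Proof.
move=> m0; rewrite (@p1E (Ordinal m0)) // /t (extend_ordE s (Ordinal m0)).
have := relE (@framed_sp d n (hi (Ordinal m0)) (Ordinal m0) (leqnn _)).
by rewrite !wprod_cons !wprod_nil !mulg1.
Qed.

Let zs j i : z j * s i = s i * z (swap i j).
Proof. by have := relE (framed_zs d i j); rewrite !wprod_cons !wprod_nil !mulg1. Qed.

Let ss i : s i * s i = 1.
Proof. by have := relE (framed_ss d i); rewrite !wprod_cons !wprod_nil !mulg1. Qed.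

Let rSE (k : nat) (kn : k.+1 < n) (i : 'I_n.-1) : i = k :> nat ->
  framed_r k.+1 = s i * framed_r k * s i.
Proof. by move=> <-; rewrite rS /t extend_ordE. Qed.

(** At index 0 these are framed relations for the first [p]. Conjugation by [s k] raises the index
    of [framed_r] and changes that of [z] by [swap k], which preserves the test of equality. *)
Let rz (i j : 'I_n) :
  framed_r i * z j = if i == j then framed_r i else z j * framed_r i.
Proof.
case: i => i ilt; rewrite -val_eqE /=.
elim: i ilt j => [|i IH] ilt j.
  rewrite (@r0E (Ordinal ilt)) //; case: eqP => j0.
    have := relE (@framed_pz d n (Ordinal ilt) j _).
    by rewrite -j0 => /(_ isT); rewrite !wprod_cons !wprod_nil !mulg1.
  have := relE (@framed_pz_comm d n (Ordinal ilt) j _).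
  rewrite lt0n eq_sym => /(_ (introN eqP j0)).
  by rewrite !wprod_cons !wprod_nil !mulg1.
have im : i < n.-1 by lia.
pose k := Ordinal im.
rewrite (@rSE i ilt k) //.
have sz : s k * z j = z (swap k j) * s k by rewrite zs /swap tpermK.
rewrite -!mulgA sz (mulgA (framed_r i)) IH ?(ltnW ilt) //.
have -> : (i == swap k j :> nat) = (i.+1 == j :> nat).
  rewrite -[i]/(val (lo k)) -[i.+1]/(val (hi k)) !val_eqE.
  by rewrite -(inj_eq (@perm_inj _ (swap k))) /swap tpermK tpermL.
case: ifP => // _.
by rewrite -!mulgA (mulgA (s k) (z _)) -zs -!mulgA.
Qed.

Let zr (i : 'I_n) : z i * framed_r i = framed_r i.
Proof.
case: i => i ilt /=.
elim: i ilt => [|i IH] ilt.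
  rewrite (@r0E (Ordinal ilt)) //.
  have := relE (@framed_zp d n (Ordinal ilt) (Ordinal ilt) (leqnn _)).
  by rewrite !wprod_cons !wprod_nil !mulg1.
have im : i < n.-1 by lia.
pose k := Ordinal im.
rewrite (@rSE i ilt k) // !mulgA zs -(mulgA (s k)).
have -> : swap k (Ordinal ilt) = Ordinal (ltnW ilt).
  have -> : Ordinal ilt = hi k by apply: val_inj.
  by rewrite /swap tpermR; apply: val_inj.
by rewrite IH.
Qed.

Lemma framed_abacus_satisfies :
  satisfies (@abacus_relation d n) framed_abacus_gen.
Proof.
have rI (j : 'I_n) : j <= n.-1.
  by rewrite -ltnS prednK // (leq_ltn_trans _ (ltn_ord j)).
have n0 (j : 'I_n) : 0 < n by apply: leq_ltn_trans (ltn_ord j).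
have tE (i : 'I_n.-1) : s i = t i by rewrite /t extend_ordE.
move=> u v [i|i j ij|i j ij|i|i j|i j jlo jhi|i|i|i|i|i j|i j|i j ij|i|i];
  rewrite ?wprod_cons ?wprod_nil ?mulg1 /framed_abacus_gen.
- exact: ss.
- by have := relE (framed_s_comm d ij); rewrite !wprod_cons !wprod_nil !mulg1.
- by have := relE (framed_s_braid d ij); rewrite !wprod_cons !wprod_nil !mulg1.
- exact: (conj_idemM rS coxeter_t (r0r0 (n0 i)) (rI i)).
- exact: (conj_idemC rS coxeter_t r0t r0tr0 p1t tp1 (rI i) (rI j)).
- rewrite tE; apply: (conj_idem_comm rS coxeter_t r0t (rI j)) => //.
  - by apply: contra_notN jlo => /eqP ji; apply: val_inj; exact: ji.
  - by apply: contra_notN jhi => /eqP ji; apply: val_inj; exact: ji.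
- by rewrite tE; exact: (conj_idem_lo rS coxeter_t (ltn_ord i)).
- by rewrite tE; exact: (conj_idem_hi rS coxeter_t (ltn_ord i)).
- rewrite tE mulgA.
  exact: (conj_idem_rsr rS coxeter_t r0t r0tr0 p1t tp1 (ltn_ord i)).
- have := relE (framed_z_pow d i); rewrite wprod_nil => <-.
  by elim: d => [|k IH]; rewrite ?wprod_nil //= !wprod_cons IH.
- by have := relE (framed_z_comm d i j); rewrite !wprod_cons !wprod_nil !mulg1.
- exact: zs.
- by rewrite rz; case: eqP.
- by rewrite rz eqxx.
- exact: zr.
Qed.

(** Both sides start at the first [p] and obey one recursion: [framed_psp] on the left,
    [conj_idem_prod_step] on the right. *)
Lemma framed_p_prod (i : 'I_n) : g (Fp i) = wprod framed_r (iota 0 i.+1).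
Proof.
case: i => i; elim: i => [|i IH] ilt.
  by rewrite wprod_seq1 (@r0E (Ordinal ilt)).
have im : i < n.-1 by lia.
have n0 : 0 < n by lia.
rewrite -(conj_idem_prod_step rS coxeter_t r0t (r0r0 n0) r0tr0 p1t tp1 im).
rewrite -(IH (ltnW ilt)) /t (extend_ordE s (Ordinal im)).
have -> : Ordinal (ltnW ilt) = lo (Ordinal im) by apply: val_inj.
by rewrite [RHS]pS; congr (g (Fp _)); apply: val_inj.
Qed.

End FramedMonoid.

(** * Rook diagrams as a model of the framed relations, and completeness *)

Section FramedRook.
Variables d n : nat.
Local Open Scope group_scope.

Definition initial_ords (i : nat) : seq 'I_n := pmap insub (iota 0 i.+1).

Lemma mem_initial_ords i (x : 'I_n) : (x \in initial_ords i) = (x <= i).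
Proof. by rewrite mem_pmap_sub mem_iota ltnS. Qed.

Definition framed_word (a : framed_generator n) : seq (abacus_generator n) :=
  match a with
  | Fs i => [:: As i]
  | Fp i => map (@Ar n) (initial_ords i)
  | Fz i => [:: Ao i]
  end.

(** The translation round trip: the abacus generators built from [g] give [g] back, so framed words
    can be compared through abacus words. *)
Lemma wprod_framed_word (M : monoidType) (g : framed_generator n -> M) a :
  satisfies (@framed_relation d n) g ->
  wprod (framed_abacus_gen g) (framed_word a) = g a.
Proof.
move=> gP; case: a => i; rewrite ?wprod_seq1 //= wprod_map (framed_p_prod gP).
have <- : map val (initial_ords i) = iota 0 i.+1.
  rewrite (pmap_filter (insubK _)); apply/all_filterP/allP => k.
  rewrite mem_iota => /andP[_ ki] /=; rewrite insubT //.
  exact: leq_trans ki (ltn_ord i).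
by rewrite wprod_map.
Qed.

Definition framed_val (a : framed_generator n) : abacus_rook d n :=
  wprod (@abacus_generator_val d n) (framed_word a).

Definition rook_p (i : 'I_n) : abacus_rook d n := framed_val (Fp i).

Lemma rook_pE i x : rook_p i x = if x <= i then None else Some (x, 0%R).
Proof. by rewrite /rook_p /framed_val wprod_map wprod_rook_r mem_initial_ords. Qed.

Lemma swapE (i : 'I_n.-1) (x : 'I_n) :
  swap i x = (if x == i :> nat then i.+1 else if x == i.+1 :> nat then i : nat else x)
    :> nat.
Proof. by rewrite -pswap_ord pswapE. Qed.

Lemma rook_sE (i : 'I_n.-1) x : rook_s d i x = Some (swap i x, 0%R).
Proof. by rewrite ffunE. Qed.

Lemma rook_oE (i x : 'I_n) :
  rook_o d i x = Some (x, if x == i then inZp 1 else 0%R).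
Proof. by rewrite ffunE. Qed.

(** The relations with [p] are checked at each top point. As [rook_p i] cuts exactly the lines up to
    [i], a swap with j < i or j > i preserves the removed segment, and with j < i it fixes every
    point beyond it. *)
Lemma framed_val_satisfies : satisfies (@framed_relation d n) framed_val.
Proof.
have sE i : framed_val (Fs i) = rook_s d i by rewrite /framed_val wprod_seq1.
have zE i : framed_val (Fz i) = rook_o d i by rewrite /framed_val wprod_seq1.
have pE i : framed_val (Fp i) = rook_p i by [].
move=> u v [i|i j ij|i j ij|i|i j|i j ij|i j ij|i j ij|i|i|i j|i j|i j ij
           |i j ij|i j ij];
  rewrite ?wprod_cons ?wprod_nil ?mulg1 ?sE ?zE ?pE.
- exact: rook_ss.
- exact: rook_s_comm.
- exact: rook_s_braid.
- apply: abacus_rookP => x; rewrite rook_mulE rook_pE.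
  by case: ifPn => // /negbTE xi; rewrite rook_pE xi GRing.addr0.
- apply: abacus_rookP => x; rewrite !rook_mulE !rook_pE.
  by case xi: (x <= i); case xj: (x <= j); rewrite ?rook_pE ?xi ?xj.
- apply: abacus_rookP => x; rewrite !rook_mulE rook_pE rook_sE rook_pE.
  have -> : (swap j x <= i) = (x <= i).
    rewrite swapE.
    by case: (x =P j :> nat) => ?; [|case: (x =P j.+1 :> nat) => ?]; lia.
  by case: ifP; rewrite // rook_sE.
- apply: abacus_rookP => x; rewrite rook_mulE rook_pE; case: leqP => // ix.
  rewrite rook_sE GRing.addr0; congr (Some (_, _)); apply: val_inj => /=.
  rewrite swapE.
  by case: (x =P j :> nat) => ?; [|case: (x =P j.+1 :> nat) => ?]; lia.
- apply: abacus_rookP => x; rewrite rook_mulE rook_sE !rook_pE.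
  have -> : (swap j x <= i) = (x <= i).
    rewrite swapE.
    by case: (x =P j :> nat) => ?; [|case: (x =P j.+1 :> nat) => ?]; lia.
  case: leqP => // ix; rewrite GRing.addr0; congr (Some (_, _)); apply: val_inj => /=.
  rewrite swapE.
  by case: (x =P j :> nat) => ?; [|case: (x =P j.+1 :> nat) => ?]; lia.
- apply: abacus_rookP => x; rewrite rook_mulE !rook_pE.
  case: leqP => [xi|ix]; first by rewrite leqW.
  move: ix; rewrite [nat_of_ord (lo i)]/= => ix.
  (* A point beyond [i] survives the first [rook_p]; the swap moves it into the removed segment
     exactly when it is [i.+1]. *)
  have hx : (x <= hi i) = (x == i.+1 :> nat) by rewrite /=; lia.
  have sx : (swap i x <= lo i) = (x == i.+1 :> nat).
    rewrite swapE /=.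
    by case: (x =P i :> nat) => ?; [|case: (x =P i.+1 :> nat) => ?]; lia.
  rewrite rook_mulE rook_sE rook_pE sx hx; case: eqP => // xi.
  rewrite !GRing.addr0; congr (Some (_, _)); apply: val_inj => /=; rewrite swapE.
  by case: (x =P i :> nat) => ?; [|case: (x =P i.+1 :> nat) => ?]; lia.
- rewrite -map_nseq wprod_map -[RHS](@rook_o_pow d n i).
  by apply: eq_bigr => k _; apply: zE.
- exact: rook_o_comm.
- exact: rook_os.
- apply: abacus_rookP => x; rewrite !rook_mulE rook_pE rook_oE rook_pE.
  case: leqP => // ix; rewrite rook_oE GRing.addr0 GRing.add0r.
  by [].
- apply: abacus_rookP => x; rewrite !rook_mulE rook_pE.
  case: leqP => // ix; rewrite rook_oE GRing.add0r.
  by case: eqP => // xj; move: ix; rewrite xj; lia.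
- apply: abacus_rookP => x; rewrite rook_mulE rook_oE !rook_pE.
  case: leqP => // ix; rewrite GRing.addr0.
  by case: eqP => // xj; move: ix; rewrite xj; lia.
Qed.

Lemma wprod_flatten (G H : Type) (M : monoidType) (h : G -> seq H) (g : H -> M) w :
  wprod g (flatten (map h w)) = wprod (fun a => wprod g (h a)) w.
Proof.
elim: w => [|a w IH]; first by rewrite !wprod_nil.
by rewrite /= wprod_cat wprod_cons IH.
Qed.

(** Framed words are translated to abacus words, compared by [abacus_complete] for the generators
    built from [g], and translated back. *)
Lemma framed_complete (M : monoidType) (g : framed_generator n -> M) u v :
  0 < d -> satisfies (@framed_relation d n) g ->
  wprod framed_val u = wprod framed_val v -> wprod g u = wprod g v.
Proof.
move=> d0 gP; rewrite /framed_val -!wprod_flatten.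
move/(abacus_complete d0 (framed_abacus_satisfies gP)).
rewrite !wprod_flatten.
have gE w :
    wprod (fun a => wprod (framed_abacus_gen g) (framed_word a)) w = wprod g w.
  by apply: eq_bigr => a _; rewrite wprod_framed_word.
by rewrite !gE.
Qed.

(** A new point x is corrected by the transposition of [s x] and [f x]; injectivity of [f] and of
    [s] keeps the earlier values away from both. *)
Lemma extend_injective (D : seq 'I_n) (f : 'I_n -> 'I_n) :
  {in D &, injective f} -> exists s : {perm 'I_n}, {in D, s =1 f}.
Proof.
elim: D => [|x D IH] injf; first by exists 1.
have [|s sE] := IH.
  by move=> y z yD zD; apply: injf; rewrite in_cons ?yD ?zD orbT.
have [xD|xD] := boolP (x \in D).
  by exists s => y; rewrite in_cons => /predU1P[->|]; apply: sE.
exists (s * tperm (s x) (f x)) => y; rewrite in_cons => /predU1P[->|yD].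
  by rewrite permM tpermL.
have yx : x != y by apply: contraNneq xD => ->.
rewrite permM (sE y yD) tpermD //.
  by rewrite -(sE y yD) (inj_eq perm_inj).
apply: contraNneq yx => fxy; apply/eqP; apply: injf => //.
  exact: mem_head.
by rewrite in_cons yD orbT.
Qed.

Lemma seq_with_counts (c : 'I_n -> nat) :
  exists a : seq 'I_n, forall i, count_mem i a = c i.
Proof.
suff [a aE] : exists a : seq 'I_n, forall i,
    count_mem i a = ((i \in enum 'I_n) * c i)%N.
  by exists a => i; rewrite aE mem_enum mul1n.
elim: (enum 'I_n) (enum_uniq 'I_n) => [_|j e IH /= /andP[je /IH[a aE]]].
  by exists [::].
exists (nseq (c j) j ++ a) => i; rewrite count_cat count_nseq aE in_cons /=.
by have [->|ij] := eqVneq i j; rewrite ?eqxx ?(negbTE je) ?addn0 // eq_sym (negbTE ij).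
Qed.

(** A normal form is read off the diagram: [r]'s at the top points on no line, [o]'s according to
    the beads, and [s]'s for a permutation extending the partial injection. *)
Lemma abacus_surjective (x : abacus_rook d n) :
  exists w, wprod (@abacus_generator_val d n) w = x.
Proof.
pose f i := if x i is Some (j, _) then j else i.
pose D := [seq i <- enum 'I_n | x i != None].
have [|s sE] := @extend_injective D f.
  move=> i j; rewrite !mem_filter /f => /andP[xi _] /andP[xj _].
  case xiE: (x i) xi => [[i' bi]|] // _; case xjE: (x j) xj => [[j' bj]|] // _ ij.
  exact: (no_shared_bottomP _ (linesP x) _ _ _ _ xiE xjE ij).
have [u uE] := perm_word s.
have [a aE] := seq_with_counts (fun i => if x i is Some (_, b) then val b else 0%N).
exists (abacus_word [seq i <- enum 'I_n | x i == None] a u).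
apply: abacus_rookP => i; rewrite abacus_word_rook mem_filter mem_enum andbT aE uE.
case xi: (x i) => [[j b]|] //=.
have iD : i \in D by rewrite mem_filter mem_enum xi.
have -> : s i = j by rewrite sE // /f xi.
by rewrite valZpK.
Qed.

(** Only the generators need lifting, and [r] is the nontrivial case: the first one is a [p], and
    each next one is a conjugate by a swap. *)
Lemma framed_surjective (x : abacus_rook d n) :
  exists w, wprod framed_val w = x.
Proof.
have [w <-] := abacus_surjective x.
have lift (y : abacus_generator n) :
    exists w, wprod framed_val w = abacus_generator_val d y.
  case: y => i; [by exists [:: Fs i]; rewrite wprod_seq1 /framed_val wprod_seq1 | |
                 by exists [:: Fz i]; rewrite wprod_seq1 /framed_val wprod_seq1].
  case: i => i; elim: i => [|i IH] ilt.
    exists [:: Fp (Ordinal ilt)]; rewrite wprod_seq1; apply: abacus_rookP => k.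
    by rewrite -/(rook_p _) rook_pE ffunE leqn0.
  have im : i < n.-1 by lia.
  have [v vE] := IH (ltnW ilt); pose k := Ordinal im.
  exists (Fs k :: v ++ [:: Fs k]); rewrite wprod_cons wprod_cat vE wprod_seq1.
  rewrite /framed_val wprod_seq1 /=.
  have -> : Ordinal (ltnW ilt) = lo k by apply: val_inj.
  rewrite rook_rs mulgA rook_ss mul1g /swap tpermL.
  by congr rook_r; apply: val_inj.
elim: w => [|y w [v vE]]; first by exists [::]; rewrite !wprod_nil.
have [u uE] := lift y; exists (u ++ v).
by rewrite wprod_cat uE vE wprod_cons.
Qed.

End FramedRook.

(** * Counting rook diagrams *)

Section CountRooks.
Variables d n : nat.
Hypothesis d_ge1 : 0 < d.

Let T (D : {set 'I_n}) : finType := {i : 'I_n | i \in D}.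

(** A line map with domain [D] is stored as its bottom endpoints and its bead labels, so that the
    two choices are counted independently. *)
Definition rook_of (D : {set 'I_n})
    (p : {ffun T D -> 'I_n} * {ffun T D -> beads d}) :
    {ffun 'I_n -> option ('I_n * beads d)} :=
  [ffun i => omap (fun x : T D => (p.1 x, p.2 x)) (insub i)].

Definition domain (f : {ffun 'I_n -> option ('I_n * beads d)}) : {set 'I_n} :=
  [set i | f i != None].

Lemma rook_of_inj D : injective (@rook_of D).
Proof.
move=> [g b] [g' b'] /ffunP E.
have gb x : (g x, b x) = (g' x, b' x).
  by have := E (val x); rewrite !ffunE valK => -[-> ->].
by congr (_, _); apply/ffunP => x; have [] := gb x.
Qed.

(** [rook_of] puts these maps in bijection with pairs of an injection from [D], counted by the
    falling factorial, and a free labelling of [D] by beads. *)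
Lemma card_rooks_with_domain (D : {set 'I_n}) :
  #|[set f | no_shared_bottom f & domain f == D]| = n ^_ #|D| * d ^ #|D|.
Proof.
have -> : [set f | no_shared_bottom f & domain f == D] =
    @rook_of D @: finset.setX [set g : {ffun T D -> 'I_n} | injectiveb g]
                             [set: {ffun T D -> beads d}].
  apply/setP => f; rewrite inE; apply/andP/imsetP => [[/no_shared_bottomP fP /eqP fD]|].
    have fx (x : T D) : {y | f (val x) = Some y}.
      have : val x \in domain f by rewrite fD (valP x).
      by rewrite inE; case: (f _) => // y _; exists y.
    exists ([ffun x => (sval (fx x)).1], [ffun x => (sval (fx x)).2]).
      rewrite !inE andbT; apply/injectiveP => x y; rewrite !ffunE.
      case: (fx x) => u /= xu; case: (fx y) => v /= yv uv.
      exact/val_inj/(fP _ _ _ _ xu yv uv).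
    apply/ffunP => i; rewrite ffunE; case: insubP => [x _ <-|iD] /=.
      by rewrite !ffunE; case: (fx x) => -[].
    by apply: contraNeq iD => fi; rewrite -fD inE.
  case=> -[g b]; rewrite !inE andbT /= => /injectiveP ginj ->; split.
    apply/no_shared_bottomP => i j x y; rewrite !ffunE.
    case: insubP => // u _ <- [<-]; case: insubP => // v _ <- [<-] /= /ginj.
    by move->.
  apply/eqP/setP => i; rewrite inE ffunE.
  by case: insubP => [u -> //|/negbTE ->].
rewrite card_imset; last exact: rook_of_inj.
rewrite cardsX cardsT card_inj_ffuns card_ffun card_ord card_ord card_sig.
by rewrite prednK.
Qed.

(** Diagrams are grouped by domain and domains by size k. One binomial coefficient counts the
    domains; the falling factorial supplies the other one and the [k!]. *)
Lemma card_abacus_rook :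
  #|{: abacus_rook d n}| = \sum_(k < n.+1) 'C(n, k) ^ 2 * k`! * d ^ k.
Proof.
rewrite card_sub.
rewrite -sum1_card (partition_big domain predT) //=.
transitivity (\sum_(D : {set 'I_n}) n ^_ #|D| * d ^ #|D|).
  apply: eq_bigr => D _; rewrite -card_rooks_with_domain sum1_card -cardsE.
  by apply: eq_card => f; rewrite !inE.
(* A domain has at most n points, so [inord] records its size faithfully. *)
rewrite (partition_big (fun D : {set 'I_n} => inord #|D| : 'I_n.+1) predT) //=.
apply: eq_bigr => k _.
rewrite (eq_bigr (fun _ => n ^_ k * d ^ k)) => [|D /eqP <-]; last first.
  by rewrite inordK // ltnS -[X in _ <= X]card_ord max_card.
rewrite sum_nat_const -bin_ffact mulnA mulnA -mulnn; congr (_ * _ * _ * _).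
rewrite -[X in 'C(X, _)]card_ord -card_draws; apply: eq_card => D.
rewrite [RHS]inE unfold_in /= inordK // ltnS -[X in _ <= X]card_ord; exact: max_card.
Qed.

End CountRooks.

(** * The two presentations and the cardinality *)

Theorem theorem3p3 (n d : nat) (n_ge1 : 1 <= n) (d_ge1 : 1 <= d) :
  has_presentation (@abacus_generator_val d n) (@abacus_relation d n) /\
  isomorphic_monoids (framed_rook d n) (abacus_rook d n) /\
  ([set: framed_rook d n] #=
     `I_(\sum_(k < n.+1) 'C(n, k) ^ 2 * k`! * d ^ k))%card.
Proof.
(* Showing that the framed relations also present the diagram monoid yields the isomorphism [f] at
   once. *)
have [f [[fM fbij] _]] : has_presentation (@framed_val d n) (@framed_relation d n).
  apply: has_presentation_complete.
  - exact: framed_val_satisfies.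
  - by move=> u v; apply: framed_complete => //; apply: presented_gen_satisfies.
  - exact: framed_surjective.
split.
  apply: has_presentation_complete.
  - exact: val_satisfies.
  - by move=> u v; apply: abacus_complete => //; apply: presented_gen_satisfies.
  - exact: abacus_surjective.
split; first by exists f.
rewrite -card_abacus_rook //.
have finj := bij_inj fbij; have [h _ Kh] := fbij.
(* The bijection [f] followed by the enumeration of diagrams reaches exactly the numbers below their
   count. *)
apply/card_set_bijP; exists (fun x => enum_rank (f x) : nat); split.
- by move=> x _ /=; apply: ltn_ord.
- by move=> x y _ _ /= /ord_inj/enum_rank_inj/finj.
- move=> k /= kn; exists (h (enum_val (Ordinal kn))) => //.
  by rewrite Kh enum_valK.
Qed.
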